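(* Let $K$ be a field, $S=K[x_1,\ldots,x_n]$, let $I\subset S$ be a nonzero squarefree monomial ideal, and let $\alpha=(a_1,\ldots,a_n)\in\mathbb{N}^n$ with $a_i\neq 0$ for all $i$. Then $\operatorname{sdepth}(I^{\alpha})=\operatorname{sdepth}(I)$.
   Context: Trivial modification: for $\alpha=(a_1,\ldots,a_n)\in\mathbb{N}^n$ with $a_i\ne0$ for all $i$, let $\sigma_\alpha:S\to S$ be the (flat) $K$-algebra morphism given by $x_i\mapsto x_i^{a_i}$ for $i=1,\ldots,n$. Then $I^{\alpha}:=\sigma_\alpha(I)S$ is called a trivial modification of the squarefree monomial ideal $I$. Stanley depth: let $M$ be a nonzero finitely generated multigraded ($\mathbb{Z}^n$-graded) $S$-module. For a homogeneous $z\in M$ and $Z\subseteq\{x_1,\ldots,x_n\}$, let $zK[Z]$ be the $K$-subspace of $M$ of all elements $zf$, $f\in K[Z]$; it is called a Stanley space of dimension $|Z|$ if it is a free $K[Z]$-module. A Stanley decomposition of $M$ is a presentation of $M$ as a finite direct sum (of $K$-vector spaces) of Stanley spaces $\mathcal{D}: M=\bigoplus_{i=1}^r z_iK[Z_i]$. Put $\operatorname{sdepth}\mathcal{D}=\min\{|Z_i| : i=1,\ldots,r\}$, and let $\operatorname{sdepth}(M)$ be the maximum of $\operatorname{sdepth}\mathcal{D}$ over all Stanley decompositions $\mathcal{D}$ of $M$. *)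

(* Defs.v *)
From HB Require Import structures.
From mathcomp Require Import all_boot all_algebra.
From mathcomp Require Import mpoly.
From mathcomp Require Import boolp.

Set Implicit Arguments.
Unset Strict Implicit.
Unset Printing Implicit Defensive.

Import GRing.Theory.
Local Open Scope ring_scope.

(* Ideals of S = {mpoly K[n]} are represented by their Prop-valued membership
   predicates, S -> Prop.  (The idealr_closed predicates of MathComp exclude
   the unit ideal, which is a squarefree monomial ideal.) *)

Section Ideals.
Variables (K : fieldType) (n : nat).
Local Notation S := {mpoly K[n]}.
Implicit Types (I G : S -> Prop) (p q : S).

Definition ideal_gen G : S -> Prop := fun p =>
  exists (r : nat) (f g : 'I_r -> S),
    (forall i, G (g i)) /\ p = \sum_(i < r) f i * g i.

Definition squarefree_mnm (m : 'X_{1..n}) : Prop := forall i, (m i <= 1)%N.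

Definition squarefree_monomial_ideal I : Prop :=
  exists M : 'X_{1..n} -> Prop,
    (forall m, M m -> squarefree_mnm m) /\
    (forall p, I p <-> ideal_gen (fun q => exists2 m, M m & q = 'X_[m]) p).

Definition nonzero_ideal I : Prop := exists2 p, I p & p <> 0.

(* The K-algebra morphism 'X_i |-> 'X_i ^+ a i, as polynomial composition. *)
Definition sigma (a : 'X_{1..n}) (p : S) : S :=
  comp_mpoly [tuple 'X_i ^+ a i | i < n] p.

Definition trivial_modification (a : 'X_{1..n}) I : S -> Prop :=
  ideal_gen (fun q => exists2 p, I p & q = sigma a p).

End Ideals.

Section StanleyDepth.
Variables (K : fieldType) (n : nat).
Local Notation S := {mpoly K[n]}.
Implicit Types (I : S -> Prop) (z p f : S) (Z : {set 'I_n}).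

(* Membership in the subalgebra K[Z] of S. *)
Definition in_KZ Z f : Prop :=
  forall m, m \in msupp f -> forall i, i \notin Z -> m i = 0%N.

(* Homogeneity for the Z^n-grading: the component of degree m of S is the line
   K * 'X_[m] if m lies in N^n, and is 0 otherwise. *)
Definition multihomogeneous z : Prop := exists (c : K) m, z = c *: 'X_[m].

(* Membership in the K-subspace zK[Z]. *)
Definition in_zKZ z Z p : Prop := exists2 f, in_KZ Z f & p = z * f.

(* zK[Z] is a free K[Z]-module with basis z; this excludes z = 0. *)
Definition free_zKZ z Z : Prop :=
  forall f g, in_KZ Z f -> in_KZ Z g -> z * f = z * g -> f = g.

Definition stanley_space I z Z : Prop :=
  [/\ I z, multihomogeneous z & free_zKZ z Z].

(* The last two clauses say that I is the sum of the subspaces z_i K[Z_i], and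
   that this sum is direct. *)
Definition stanley_decomposition I r (z : 'I_r -> S) (Z : 'I_r -> {set 'I_n}) :
    Prop :=
  [/\ forall i, stanley_space I (z i) (Z i),
      forall p, I p <->
        exists2 u : 'I_r -> S,
          forall i, in_zKZ (z i) (Z i) (u i) & p = \sum_(i < r) u i
    & forall u : 'I_r -> S, (forall i, in_zKZ (z i) (Z i) (u i)) ->
        \sum_(i < r) u i = 0 -> forall i, u i = 0].

(* As #|Z i| <= n, the neutral element n of the minimum is never smaller than
   the actual minimum, and is reached as a default only when r = 0, i.e. for a
   decomposition of the zero ideal. *)
Definition sdepth_decomposition r (Z : 'I_r -> {set 'I_n}) : nat :=
  \big[minn/n]_(i < r) #|Z i|.

(* The depth of a decomposition never exceeds n, so that it is enough to take
   the maximum over d <= n. *)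
Definition sdepth I : nat :=
  \max_(d < n.+1 | `[< exists (r : nat) (z : 'I_r -> S) (Z : 'I_r -> {set 'I_n}),
      stanley_decomposition I z Z /\ sdepth_decomposition Z = d >]) d.

End StanleyDepth.

(* Main.v *)
Require Import Defs.
From mathcomp Require Import all_boot all_algebra.
From mathcomp Require Import mpoly.
From mathcomp Require Import boolp.

Set Implicit Arguments.
Unset Strict Implicit.
Unset Printing Implicit Defensive.

Import GRing.Theory.

(** A monomial ideal is determined by the set A of exponents of its monomials,
an up-set of N^n, and a Stanley space c x^m K[Z] is the span of the monomials
with exponents in the cell { m + k : k supported on Z }.  A Stanley
decomposition is therefore nothing but a finite partition of A into cells
([stanley_decomposition_cells]), so that Stanley depth is a purely
combinatorial invariant of A.

Let [scale_mnm a] be the map m |-> (a_i m_i) of N^n, and [quot_mnm a] its left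
inverse b |-> (floor (b_i / a_i)).  A monomial x^b lies in the modified ideal
exactly when some x^(a m) with m in A divides it, that is, when [quot_mnm a b]
is in A.  So the exponent set of the modification is the preimage of A under
[quot_mnm a], and A in turn is the preimage of that set under [scale_mnm a].

Under both maps the preimage of a cell with free directions Z is a finite
disjoint union of cells with the same Z:
- under [scale_mnm a] it is empty or a single cell, since a_i b_i = m_i has at
  most one solution and a_i b_i >= m_i amounts to b_i >= ceil (m_i / a_i);
- under [quot_mnm a], the equation floor (b_i / a_i) = m_i for i outside Z has
  a_i solutions, while floor (b_i / a_i) >= m_i for i in Z amounts to
  b_i >= a_i m_i; hence there is one cell for each choice of the coordinates
  outside Z.

Pulling a partition back along either map creates no new set of free
directions, so the depth does not drop ([sdepth_preimage_le]).  Applying this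
to the two maps gives the two inequalities. *)

(** * Cells and their preimages *)

Section Cells.
Variable n : nat.
Implicit Types (m b c : 'X_{1..n}) (Z : {set 'I_n}) (A : pred 'X_{1..n}).
Implicit Types (s : seq ('X_{1..n} * {set 'I_n})).

Definition cell m Z : pred 'X_{1..n} :=
  fun b => [forall i, if i \in Z then m i <= b i else b i == m i].

Lemma cellP m Z b :
  reflect (forall i, if i \in Z then m i <= b i else b i == m i) (cell m Z b).
Proof. exact: forallP. Qed.

Lemma cell_corner m Z : cell m Z m.
Proof. by apply/cellP => i; case: ifP. Qed.

Lemma cell_lem m Z b : cell m Z b -> (m <= b)%MM.
Proof.
move=> /cellP mb; apply/mnm_lepP => i; move: (mb i).
by case: ifP => // _ /eqP->.
Qed.

(** Counting the cells through each point expresses both halves of the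
partition property, covering A and disjointness, in one equation, and this
equation behaves well under concatenation of lists. *)
Definition cell_partition A s : Prop :=
  forall b, count (fun B => cell B.1 B.2 b) s = A b.

(** Only the corners may vary: keeping the set Z of free directions for all pieces
is what lets Stanley depth be transported along [h]. *)
Definition cellwise_preimage (h : 'X_{1..n} -> 'X_{1..n}) : Prop :=
  forall m Z, exists cs : seq 'X_{1..n},
    forall b, count (fun c => cell c Z b) cs = cell m Z (h b).

(** Replace each cell of the partition by the cells that make up its preimage. *)
Lemma cell_partition_preimage h A s :
  cellwise_preimage h -> cell_partition A s ->
  exists2 s', cell_partition (A \o h) s' &
    {subset [seq B.2 | B <- s'] <= [seq B.2 | B <- s]}.
Proof.
move=> hcell sA.
have [g gE] := choice (fun B => hcell B.1 B.2).
exists (flatten [seq [seq (c, B.2) | c <- g B] | B <- s]).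
  move=> b; rewrite /= -sA count_flatten.
  elim: s {sA} => //= B s ->; congr (_ + _).
  by rewrite count_map -gE; apply: eq_count.
move=> Z /mapP[B /flattenP[t /mapP[B0 B0s ->]] /mapP[c _ ->]] ->.
by apply/mapP; exists B0.
Qed.

Variable a : 'X_{1..n}.

Definition scale_mnm m : 'X_{1..n} := [multinom a i * m i | i < n].
Definition quot_mnm m : 'X_{1..n} := [multinom m i %/ a i | i < n].

Lemma scale_mnmK : (forall i, 0 < a i) -> cancel scale_mnm quot_mnm.
Proof. by move=> a_gt0 m; apply/mnmP => i; rewrite !mnmE mulKn. Qed.

Lemma scale_quot_lem m : (scale_mnm (quot_mnm m) <= m)%MM.
Proof. by apply/mnm_lepP => i; rewrite !mnmE mulnC leq_trunc_div. Qed.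

(** The inequality m_i <= a_i b_i means ceil (m_i / a_i) <= b_i, and the equation
a_i b_i = m_i means that a_i divides m_i and b_i is that same rounded quotient.
So the preimage is one cell, or empty when a divisibility fails. *)
Lemma cellwise_preimage_scale :
  (forall i, 0 < a i) -> cellwise_preimage scale_mnm.
Proof.
move=> a_gt0 m Z.
(* The corner c is the quotient of m by a, rounded up. *)
pose c : 'X_{1..n} := [multinom (m i + (a i).-1) %/ a i | i < n].
exists (if [forall i, (i \notin Z) ==> (a i %| m i)] then [:: c] else [::]).
have cE i (k : nat) : (c i <= k) = (m i <= a i * k).
  rewrite mnmE -ltnS ltn_divLR// mulSn mulnC.
  by rewrite -{2}(prednK (a_gt0 i)) addSn addnC ltnS leq_add2l.
move=> b; case: ifP => [/forallP div | /forallP ndiv] /=; last first.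
  case: cellP => // mb; case: ndiv => i; apply/implyP => iZ.
  by move: (mb i); rewrite (negPf iZ) mnmE => /eqP<-; rewrite dvdn_mulr.
rewrite addn0; congr (nat_of_bool _); apply: eq_forallb => i.
rewrite [scale_mnm b i]mnmE cE; case: ifPn => // iZ.
move: (div i); rewrite iZ /= => /dvdnP[q mq].
have -> : c i = q.
  apply/eqP; rewrite eqn_leq cE mq mulnC leqnn /=.
  by have := leqnn (c i); rewrite cE mq mulnC leq_pmul2l.
by rewrite mq mulnC eqn_pmul2r.
Qed.

(** The corners c of the cells in the preimage are the solutions of
floor (c / a) = m with c_i divisible by a_i for i in Z.  A point b lies in at
most one of these cells, because its corner must be obtained from b by
replacing b_i with a_i m_i for i in Z. *)
Lemma cellwise_preimage_quot :
  (forall i, 0 < a i) -> cellwise_preimage quot_mnm.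
Proof.
move=> a_gt0 m Z.
pose P : pred 'X_{1..n} :=
  fun c => (quot_mnm c == m) && [forall i in Z, a i %| c i].
(* Every corner is bounded by a m + a, which makes the list of corners finite:
   it is filtered from the exponents of total degree less than N. *)
pose N := (mdeg (scale_mnm m + a)%MM).+1.
pose cs := [seq c <- [seq val x | x <- enum {: 'X_{1..n < N}}] | P c].
have csE c : (c \in cs) = P c.
  rewrite mem_filter; case Pc : (P c) => //=.
  have cN : mdeg c < N.
    rewrite ltnS -(@submK _ c (scale_mnm m + a)%MM) ?mdegD ?leq_addl//.
    case/andP: Pc => /eqP <- _; apply/mnm_lepP => i.
    by rewrite mnmDE !mnmE mulnC addnC -mulSn ltnW// ltn_ceil.
  by apply/mapP; exists (BMultinom cN); rewrite // mem_enum.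
exists cs => b.
(* The only possible corner of a cell through b. *)
pose c0 : 'X_{1..n} := [multinom if i \in Z then a i * m i else b i | i < n].
have cell_csE c : c \in cs -> cell c Z b = (c == c0) && cell m Z (quot_mnm b).
  rewrite csE => /andP[/eqP cm /forall_inP cZ].
  have cmE i : c i %/ a i = m i by rewrite -cm mnmE.
  have cZE i : i \in Z -> c i = a i * m i.
    by move=> iZ; rewrite -cmE mulnC divnK ?cZ.
  apply/cellP/andP => [cb|[/eqP c0E /cellP mb] i].
    split.
      apply/eqP/mnmP => i; rewrite mnmE; move: (cb i).
      by case: ifP => [iZ _|_ /eqP->//]; apply: cZE.
    apply/cellP => i; rewrite mnmE -cmE; move: (cb i).
    by case: ifP => [_ /leq_div2r->|_ /eqP->].
  move: (mb i); rewrite c0E !mnmE; case: ifP => // _.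
  by rewrite leq_divRL// mulnC.
rewrite (eq_in_count cell_csE).
case mb: (cell m Z (quot_mnm b)); last first.
  apply/eqP; rewrite -leqn0 leqNgt -has_count.
  by apply/hasPn => c; rewrite andbF.
have -> : count (fun c => (c == c0) && true) cs = count_mem c0 cs.
  by apply: eq_count => c; rewrite /= andbT.
rewrite count_uniq_mem; last first.
  by rewrite filter_uniq// (map_inj_uniq val_inj) enum_uniq.
rewrite csE; congr (nat_of_bool _); apply/andP; split.
  apply/eqP/mnmP => i; rewrite !mnmE; move/cellP: mb => /(_ i).
  by rewrite mnmE; case: ifP => [_ _|_ /eqP//]; rewrite mulKn.
by apply/forall_inP => i iZ; rewrite mnmE iZ dvdn_mulr.
Qed.

End Cells.

(** * Stanley decompositions as partitions into cells *)

Section Supports.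
Variables (K : fieldType) (n : nat).
Local Notation S := {mpoly K[n]}.
Implicit Types (I : S -> Prop) (p z : S) (A : pred 'X_{1..n}).
Implicit Types (m b : 'X_{1..n}) (Z : {set 'I_n}).
Local Open Scope ring_scope.

(** The bridge to combinatorics: being the K-span of a set of monomials is a
condition on supports, shared by monomial ideals and by Stanley spaces. *)
Definition spanned_by A I : Prop := forall p, I p <-> {subset msupp p <= A}.

Lemma msupp_sum_sub A (T : Type) (r : seq T) (P : pred T) (F : T -> S) :
  (forall i, P i -> {subset msupp (F i) <= A}) ->
  {subset msupp (\sum_(i <- r | P i) F i) <= A}.
Proof.
move=> FA; elim/big_ind: _ => [b|p q pA qA b|//]; first by rewrite msupp0.
by move=> /msuppD_le; rewrite mem_cat => /orP[/pA|/qA].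
Qed.

Lemma in_zKZ_cell (c : K) m Z p :
  c != 0 -> in_zKZ (c *: 'X_[m]) Z p <-> {subset msupp p <= cell m Z}.
Proof.
move=> c0; split=> [[f fKZ ->] b|pm].
  rewrite -scalerAl => /msuppZ_le; rewrite mulrC (perm_mem (msuppMX f m)).
  case/mapP=> k /fKZ kZ ->; apply/cellP => i; rewrite mnmDE.
  by case: ifPn => [_|/kZ->]; rewrite ?addn0 ?leq_addr.
exists (c^-1 *: \sum_(b <- msupp p) p@_b *: 'X_[b - m]); last first.
  rewrite -scalerAl -scalerAr scalerA mulfV// scale1r mulr_sumr {1}(mpolyE p).
  apply: eq_big_seq => b /pm /cell_lem mb.
  by rewrite -scalerAr -mpolyXD addmC submK.
move=> k /msuppZ_le kf i iZ; apply/eqP; move: k kf.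
rewrite big_seq; apply: msupp_sum_sub => b /pm /cellP/(_ i) mb k.
move=> /msuppZ_le; rewrite msuppX inE => /eqP->.
by move: mb; rewrite (negPf iZ) unfold_in mnmBE => /eqP->; rewrite subnn.
Qed.

(** Everything is read off from coefficients: a monomial of [I] is a sum of
elements of the Stanley spaces, one of which has it in its support; two
of the spaces that share a monomial violate directness through the sum
'X_[b] - 'X_[b]; conversely a polynomial splits along a partition of
its support. *)
Lemma stanley_decomposition_cells A I r (c : 'I_r -> K)
    (m : 'I_r -> 'X_{1..n}) (Z : 'I_r -> {set 'I_n}) :
  spanned_by A I -> (forall i, c i != 0) ->
  stanley_decomposition I (fun i => c i *: 'X_[m i]) Z <->
  (forall b, (\sum_(i < r) cell (m i) (Z i) b)%N = A b).
Proof.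
move=> AI c0; pose C i := cell (m i) (Z i).
have zC i p : in_zKZ (c i *: 'X_[m i]) (Z i) p <-> {subset msupp p <= C i}.
  exact: in_zKZ_cell.
have X_sub (B : pred 'X_{1..n}) b : {subset msupp ('X_[b] : S) <= B} <-> B b.
  rewrite msuppX; split=> [bB|bB x]; first by apply: bB; rewrite mem_head.
  by rewrite inE => /eqP->.
split=> [[spc IE direct] b|cover].
  have CA i : C i b -> A b.
    move=> ib; apply/X_sub/AI/IE.
    exists (fun j => if j == i then 'X_[b] else 0); last first.
      by rewrite -big_mkcond big_pred1_eq.
    by move=> j; apply/zC; case: eqP => [->|_ x]; [apply/X_sub|rewrite msupp0].
  case Ab: (A b); last first.
    rewrite big1 // => i _; apply/eqP; rewrite eqb0.
    by apply/negP => /CA; rewrite Ab.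
  have [u uC XE] : exists2 u : 'I_r -> S,
      forall i, in_zKZ (c i *: 'X_[m i]) (Z i) (u i)
      & 'X_[b] = \sum_(i < r) u i.
    by apply/IE/AI/X_sub.
  have [i iC] : exists i, C i b.
    apply/existsP; apply: contraT => /existsPn nC.
    have /eqP := congr1 (mcoeff b) XE.
    rewrite mcoeffX eqxx raddf_sum big1 ?oner_eq0//= => i _.
    apply/eqP; rewrite mcoeff_eq0.
    by apply: contra (nC i) => /(proj1 (zC i _) (uC i)).
  rewrite (bigD1 i)//= -/(C i) iC big1 // => j ji.
  apply/eqP; rewrite eqb0; apply/negP => jC.
  pose v k : S := if k == i then 'X_[b] else if k == j then - 'X_[b] else 0.
  suff /eqP : v i = 0.
    by rewrite /v eqxx -msupp_eq0 msuppX.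
  apply: direct => [k|].
    apply/zC; rewrite /v; case: eqP => [->|_]; first exact/X_sub.
    case: eqP => [->|_ x]; last by rewrite msupp0.
    by move=> x; rewrite (perm_mem (msuppN _)); exact: (proj2 (X_sub _ _) jC).
  rewrite (bigD1 i)//= (bigD1 j)//= /v eqxx (negPf ji) eqxx.
  rewrite big1 ?addr0 ?subrr//.
  by move=> k /andP[/negPf-> /negPf->].
have CA i : {subset C i <= A}.
  move=> b ib; have := cover b; rewrite (bigD1 i)//= -/(C i) (ib : C i b).
  by rewrite -[b \in A]/(A b); case: (A b).
split=> [i|p|u uC u0 i].
- split.
  + apply/AI => b /msuppZ_le; rewrite msuppX inE => /eqP->.
    exact/CA/cell_corner.
  + by exists (c i), (m i).
  + move=> f g _ _; apply: mulfI.
    by rewrite scaler_eq0 negb_or c0 -msupp_eq0 msuppX.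
- split=> [/AI pA|[u uC ->]]; last first.
    by apply/AI/msupp_sum_sub => i _ b /(proj1 (zC i _) (uC i)) /CA.
  exists (fun i => \sum_(b <- msupp p | C i b) p@_b *: 'X_[b]).
    move=> i; apply/zC/msupp_sum_sub => b ib x /msuppZ_le.
    by rewrite msuppX inE => /eqP->.
  under eq_bigr do rewrite big_mkcond.
  rewrite exchange_big {1}(mpolyE p); apply: eq_big_seq => b /pA Ab.
  transitivity (p@_b *: 'X_[b] *+ (\sum_(i < r) C i b)%N).
    by rewrite cover [A b]Ab.
  rewrite -sumrMnr; apply: eq_bigr => i _.
  by case: (C i b); rewrite ?mulr1n ?mulr0n.
apply/eqP; rewrite -msupp_eq0; apply/eqP.
case E: (msupp (u i)) => [//|b t].
have bu : b \in msupp (u i) by rewrite E mem_head.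
have iC : C i b by apply: (proj1 (zC i _) (uC i)).
have := congr1 (mcoeff b) u0.
rewrite raddf_sum (bigD1 i)//= mcoeff0 big1 => [|j ji].
  by move=> /eqP; rewrite addr0 mcoeff_eq0 bu.
apply/eqP; rewrite mcoeff_eq0; apply/negP => /(proj1 (zC j _) (uC j)) jC.
have := cover b; rewrite (bigD1 i)//= (bigD1 j)//= -/(C i) -/(C j).
by rewrite iC (jC : C j b); case: (A b).
Qed.

(** The generators of a Stanley decomposition are homogeneous, hence monomials up
to a scalar, and freeness makes the scalar nonzero. *)
Lemma cell_partition_of_decomposition A I r (z : 'I_r -> S)
    (Z : 'I_r -> {set 'I_n}) :
  spanned_by A I -> stanley_decomposition I z Z ->
  exists2 s, cell_partition A s & [seq B.2 | B <- s] = codom Z.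
Proof.
move=> AI dec; have [spc _ _] := dec.
have /choice[cm cmP] i : exists cm : K * 'X_{1..n},
    z i = cm.1 *: 'X_[cm.2] /\ cm.1 != 0.
  have [_ [c [m zE]] free] := spc i; exists (c, m); split=> //=.
  apply/eqP => c0; suff /eqP : (1 : S) = 0 by rewrite oner_eq0.
  apply: free => [k|k|]; last by rewrite zE c0 scale0r !mul0r.
    by rewrite msupp1 inE => /eqP-> j _; rewrite mnm0E.
  by rewrite msupp0.
have zE : z = fun i => (cm i).1 *: 'X_[(cm i).2].
  by apply: funext => i; have [] := cmP i.
rewrite zE in dec.
have cm0 i : (cm i).1 != 0 by have [] := cmP i.
have cover := proj1 (stanley_decomposition_cells _ _ AI cm0) dec.
exists [seq ((cm i).2, Z i) | i <- enum 'I_r]; last by rewrite -map_comp.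
by move=> b; rewrite count_map -cover -sumn_count sumnE big_map big_enum.
Qed.

(** * Comparison of Stanley depths *)

Lemma bigmin_nat_le (T : eqType) (d : nat) (r : seq T) (F : T -> nat) x :
  x \in r -> (\big[minn/d]_(i <- r) F i <= F x)%N.
Proof.
elim: r => // y r IH; rewrite inE big_cons geq_min.
by case/orP => [/eqP->|/IH->]; rewrite ?leqnn ?orbT.
Qed.

(** Pull an optimal partition back along [h].  Cells may disappear in the
process, so the minimal dimension of the new partition may be larger than the
old one: only an inequality holds for a single decomposition. *)
Lemma sdepth_preimage_le h A I I' :
  cellwise_preimage h -> spanned_by A I -> spanned_by (A \o h) I' ->
  (sdepth I <= sdepth I')%N.
Proof.
move=> hcell AI AI'; apply/bigmax_leqP => d /asboolP[r [z [Z [dec dE]]]].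
have [s sA sZ] := cell_partition_of_decomposition AI dec.
have [s' s'A s'Z] := cell_partition_preimage hcell sA.
pose t := tnth (in_tuple s').
pose z' i : S := 1 *: 'X_[(t i).1].
have dec' : stanley_decomposition I' z' (fun i => (t i).2).
  apply/(stanley_decomposition_cells _ _ AI').
    by move=> _; rewrite oner_neq0.
  move=> b; rewrite -s'A -sumn_count sumnE big_map big_tnth.
  by apply: eq_bigr.
pose d' := sdepth_decomposition (fun i => (t i).2).
have d'n : (d' < n.+1)%N.
  rewrite ltnS /d' /sdepth_decomposition; elim/big_rec: _ => // i x _ xn.
  by rewrite geq_min xn orbT.
apply: (@leq_trans d'); last first.
  apply: (@leq_bigmax_cond _ _ (fun i : 'I_n.+1 => i : nat) (Ordinal d'n)).
  by apply/asboolP; exists (size s'), z', (fun i => (t i).2).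
rewrite /d' /sdepth_decomposition; elim/big_ind: _ => [|x y dx dy|i _].
- by rewrite -ltnS.
- by rewrite leq_min dx.
have : (t i).2 \in [seq B.2 | B <- s] by apply/s'Z/map_f/mem_tnth.
rewrite sZ => /codomP[j ->]; rewrite -dE.
by apply: (bigmin_nat_le n (fun i => #|Z i|)); rewrite mem_index_enum.
Qed.

(** * Exponent sets of monomial ideals and of their modifications *)

Definition upward_closed A : Prop := forall m b, (m <= b)%MM -> A m -> A b.

(** Common to an ideal generated by monomials and to its modification: the
generators of the latter need not be monomials, but it is enough that their
supports lie in [A] and that the monomial generators reach below all of [A]. *)
Lemma ideal_gen_spanned A (G : S -> Prop) :
  upward_closed A -> (forall q, G q -> {subset msupp q <= A}) ->
  (forall b, A b -> exists2 m, (m <= b)%MM & G 'X_[m]) ->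
  spanned_by A (ideal_gen G).
Proof.
move=> Aup GA AG p; split=> [[r [f [g [Gg ->]]]]|pA].
  apply: msupp_sum_sub => i _ b /msuppM_le /allpairsP[[k m] /= [_ mg ->]].
  by apply: (Aup m); [exact: lem_addl|exact: (GA _ (Gg i))].
pose b := tnth (in_tuple (msupp p)).
have /choice[m mP] i : exists m, (m <= b i)%MM /\ G 'X_[m].
  have [|m mb Gm] := AG (b i); last by exists m.
  by apply: pA; exact: mem_tnth.
exists (size (msupp p)), (fun i => p@_(b i) *: 'X_[b i - m i]).
exists (fun i => 'X_[m i]).
split=> [i|]; first by have [] := mP i.
rewrite {1}(mpolyE p) big_tnth; apply: eq_bigr => i _.
by rewrite -scalerAl -mpolyXD submK//; have [] := mP i.
Qed.

Lemma squarefree_ideal_spanned I : squarefree_monomial_ideal I ->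
  exists2 A, upward_closed A & spanned_by A I.
Proof.
case=> M [_ IM]; pose A b := `[< exists2 m, M m & (m <= b)%MM >].
have Aup : upward_closed A.
  move=> m b mb /asboolP[k Mk km]; apply/asboolP; exists k => //.
  exact: lepm_trans mb.
exists A => // p; rewrite IM; apply: ideal_gen_spanned => // [q [m Mm ->] b|b].
  rewrite msuppX inE => /eqP->; apply/asboolP; exists m => //.
  exact: lepm_refl.
by move=> /asboolP[m Mm mb]; exists m => //; exists m.
Qed.

Lemma sigmaX (a m : 'X_{1..n}) : sigma a ('X_[m] : S) = 'X_[scale_mnm a m].
Proof.
rewrite /sigma comp_mpolyX [RHS]mpolyXE_id; apply: eq_bigr => i _.
by rewrite tnth_mktuple -exprM mnmE.
Qed.

Lemma msupp_sigma (a b : 'X_{1..n}) p : b \in msupp (sigma a p) ->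
  exists2 m, m \in msupp p & b = scale_mnm a m.
Proof.
suff sub : {subset msupp (sigma a p) <= [seq scale_mnm a m | m <- msupp p]}.
  by move=> /sub/mapP.
rewrite {1}(mpolyE p) /sigma raddf_sum big_seq; apply: msupp_sum_sub => m mp k.
rewrite /= comp_mpolyZ -/(sigma a _) sigmaX => /msuppZ_le.
by rewrite msuppX inE => /eqP->; apply: map_f.
Qed.

(** Among the monomials x^(a m), the largest one dividing x^b in every variable is
obtained for m = floor (b / a); as [A] is an up-set, only this m matters. *)
Lemma trivial_modification_spanned (a : 'X_{1..n}) A I :
  (forall i, 0 < a i)%N -> upward_closed A -> spanned_by A I ->
  spanned_by (A \o quot_mnm a) (trivial_modification a I).
Proof.
move=> a0 Aup AI; apply: ideal_gen_spanned => [m b mb|q [p Ip ->] b|b Ab].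
- apply: Aup; apply/mnm_lepP => i; rewrite !mnmE; apply: leq_div2r.
  exact/mnm_lepP.
- case/msupp_sigma => m mp ->; rewrite unfold_in /= scale_mnmK //.
  exact: (proj1 (AI p)).
exists (scale_mnm a (quot_mnm a b)); first exact: scale_quot_lem.
exists 'X_[quot_mnm a b]; last by rewrite sigmaX.
by apply/AI => m; rewrite msuppX inE => /eqP->.
Qed.
End Supports.

Theorem theorem2p6 (K : fieldType) (n : nat) (I : {mpoly K[n]} -> Prop)
    (alpha : 'X_{1..n}) :
  squarefree_monomial_ideal I ->
  nonzero_ideal I ->
  (forall i : 'I_n, alpha i <> 0%N) ->
  sdepth (trivial_modification alpha I) = sdepth I.
Proof.
move=> /squarefree_ideal_spanned[A Aup AI] _ alpha_neq0.
have alpha_gt0 i : 0 < alpha i by rewrite lt0n; apply/eqP.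
have AI' := trivial_modification_spanned alpha_gt0 Aup AI.
apply/anti_leq/andP; split; last first.
  exact: sdepth_preimage_le (cellwise_preimage_quot alpha_gt0) AI AI'.
apply: sdepth_preimage_le (cellwise_preimage_scale alpha_gt0) AI' _.
have -> // : (A \o quot_mnm alpha) \o scale_mnm alpha = A.
by apply: funext => m; rewrite /= scale_mnmK.
Qed.
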